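(* Let $(A_m,B_m,C_m)_{m\ge0}$ be defined by $A_0=B_0=C_0=0$, $A_1=1$, $B_1=2$, $C_1=3$ and for $m>1$: $A_m=\mathrm{mex}\{A_i,B_i,C_i:0\le i<m\}$, $B_m=A_m+1$, and $C_m=C_{m-1}+3$ if $A_m-A_{m-1}=2$, $C_m=C_{m-1}+5$ otherwise (the $\mathcal{P}$-positions of the Raleigh game are these triples and their permutations). A triple $(a,b,c)$ of positive integers with $a<b<c$ equals $(A_m,B_m,C_m)$ for some $m\ge1$ if and only if there is a word $w$ over $\{0,1\}$ such that, up to leading zeroes, $\mathrm{rep}_F(a-1)=w00$, $\mathrm{rep}_F(b-1)=w01$ and $\mathrm{rep}_F(c-1)=w010$.
   Context: $\mathrm{mex}(S)$ is the smallest non-negative integer not in $S$. Let $(F_i)_{i\ge0}$ be given by $F_0=1$, $F_1=2$, $F_{i+2}=F_{i+1}+F_i$. $\mathrm{rep}_F(m)$ is the greedy (Zeckendorf) expansion of $m$ in this system: the word $c_\ell\cdots c_0$ over $\{0,1\}$ with no factor $11$, $c_\ell=1$, and $m=\sum c_iF_i$; $\mathrm{rep}_F(0)$ is the empty word. ''Up to leading zeroes'' means the two words become equal after deleting initial zeroes. *)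

(* Defs.v *)
From mathcomp Require Import all_boot zify.

Set Implicit Arguments.
Unset Strict Implicit.
Unset Printing Implicit Defensive.

Lemma exists_notin (S : seq nat) : exists n, n \notin S.
Proof.
exists (\max_(i <- S) i).+1; apply/negP => inS.
by have := @leq_bigmax_seq _ S xpredT id _ inS isT; rewrite ltnn.
Qed.

Definition mex (S : seq nat) : nat := ex_minn (exists_notin S).

Lemma mexP (S : seq nat) n :
  reflect (n \notin S /\ forall k, k \notin S -> n <= k) (mex S == n).
Proof.
rewrite /mex; case: ex_minnP => k kS kmin; apply: (iffP eqP) => [<- //|[nS nmin]].
by apply/eqP; rewrite eqn_leq kmin // nmin.
Qed.

(* [:: (A_0, B_0, C_0); ...; (A_m, B_m, C_m)] *)
Fixpoint raleigh_upto (m : nat) : seq (nat * nat * nat) :=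
  match m with
  | 0 => [:: (0, 0, 0)]
  | 1 => [:: (0, 0, 0); (1, 2, 3)]
  | m'.+1 =>
      let s := raleigh_upto m' in
      let: (a', _, c') := last (0, 0, 0) s in
      let a := mex (flatten [seq [:: t.1.1; t.1.2; t.2] | t <- s]) in
      rcons s (a, a + 1, if a - a' == 2 then c' + 3 else c' + 5)
  end.

Definition raleigh (m : nat) := last (0, 0, 0) (raleigh_upto m).
Definition raleighA (m : nat) : nat := (raleigh m).1.1.
Definition raleighB (m : nat) : nat := (raleigh m).1.2.
Definition raleighC (m : nat) : nat := (raleigh m).2.

Lemma raleigh_uptoE m : raleigh_upto m = [seq raleigh i | i <- iota 0 m.+1].
Proof.
elim: m => // -[//|m] IHm.
rewrite -[m.+3]addn1 iotaD map_cat -IHm cats1 add0n /= /raleigh /=.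
by case: (last _ _) => [[a' b'] c']; rewrite last_rcons.
Qed.

Lemma raleigh0 : [/\ raleighA 0 = 0, raleighB 0 = 0 & raleighC 0 = 0].
Proof. by []. Qed.

Lemma raleigh1 : [/\ raleighA 1 = 1, raleighB 1 = 2 & raleighC 1 = 3].
Proof. by []. Qed.

Lemma raleigh_rec m : 1 < m ->
  [/\ raleighA m =
        mex (flatten [seq [:: raleighA i; raleighB i; raleighC i]
                     | i <- iota 0 m]),
      raleighB m = raleighA m + 1 &
      raleighC m = if raleighA m - raleighA m.-1 == 2
                   then raleighC m.-1 + 3 else raleighC m.-1 + 5].
Proof.
case: m => [|[|m]] // _; rewrite /raleighA /raleighB /raleighC.
have -> : raleigh m.+2 =
    let: (a', _, c') := raleigh m.+1 in
    let a := mex (flatten [seq [:: t.1.1; t.1.2; t.2]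
                          | t <- raleigh_upto m.+1]) in
    (a, a + 1, if a - a' == 2 then c' + 3 else c' + 5).
  rewrite /raleigh -[raleigh_upto m.+2]/(let s := raleigh_upto m.+1 in
    let: (a', _, c') := last (0, 0, 0) s in
    let a := mex (flatten [seq [:: t.1.1; t.1.2; t.2] | t <- s]) in
    rcons s (a, a + 1, if a - a' == 2 then c' + 3 else c' + 5)).
  move: (raleigh_upto m.+1) => s.
  by case E: (last _ s) => [[a' b'] c']; rewrite /= E last_rcons.
rewrite raleigh_uptoE -map_comp; rewrite [m.+2.-1]/=.
by case: (raleigh m.+1) => [[a' b'] c'].
Qed.

Fixpoint F (i : nat) : nat :=
  match i with
  | 0 => 1
  | 1 => 2
  | (i'.+1 as j).+1 => F j + F i'
  end.

(* Words over {0,1} are bit sequences written with the most significant digit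
   first: c_l ... c_0 is [:: c_l; ...; c_0]. *)
Definition del_zeroes (u : seq bool) : seq bool := drop (find id u) u.

Definition eq_upto_zeroes (u v : seq bool) : Prop :=
  del_zeroes u = del_zeroes v.

Fixpoint greedy (k m : nat) : seq bool :=
  if k is i.+1 then
    if F i <= m then true :: greedy i (m - F i) else false :: greedy i m
  else [::].

(* Since m < F_m, the digits of weight F_(m-1), ..., F_0 suffice. *)
Definition rep_F (m : nat) : seq bool := del_zeroes (greedy m m).

Definition val_F (u : seq bool) : nat :=
  \sum_(i < size u) nth false (rev u) i * F i.

(* For u = [::] the second condition is vacuous. *)
Definition zeckendorf (m : nat) (u : seq bool) : bool :=
  [&& ~~ infix [:: true; true] u, head true u & val_F u == m].

Lemma F_rec i : F i.+2 = F i.+1 + F i. Proof. by []. Qed.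

Lemma F_gt i : i < F i.
Proof.
suff : i < F i /\ i.+1 < F i.+1 by case.
by elim: i => // i [h1 h2]; split=> //; rewrite F_rec; lia.
Qed.

Lemma F_leS i : F i <= F i.+1.
Proof. by case: i => // i; rewrite F_rec leq_addr. Qed.

Lemma F_mono i j : i <= j -> F i <= F j.
Proof.
elim: j => [|j IH]; first by rewrite leqn0 => /eqP->.
rewrite leq_eqVlt ltnS => /orP[/eqP-> //|/IH h]; exact: leq_trans h (F_leS j).
Qed.

Lemma val_F_cons b u : val_F (b :: u) = b * F (size u) + val_F u.
Proof.
rewrite /val_F /= big_ord_recr /= addnC rev_cons; congr (_ + _).
  by rewrite nth_rcons size_rev ltnn eqxx.
by apply: eq_bigr => i _; rewrite nth_rcons size_rev ltn_ord.
Qed.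

Lemma infix11_cons b u :
  infix [:: true; true] (b :: u) =
  (b && head false u) || infix [:: true; true] u.
Proof. by case: b; case: u => [|[] [|c u]]. Qed.

Lemma greedyP k m : m < F k ->
  [/\ size (greedy k m) = k, val_F (greedy k m) = m,
      ~~ infix [:: true; true] (greedy k m) &
      0 < k -> head false (greedy k m) = (F k.-1 <= m)].
Proof.
elim: k m => [|k IH] m ltm.
  by split => //; rewrite /val_F big_ord0; move: ltm; rewrite /=; lia.
rewrite [greedy _ _]/=; case: (leqP (F k) m) => [le|lt]; last first.
  case: (IH m lt) => s v n h; split.
  - by rewrite /= s.
  - by rewrite val_F_cons v.
  - by rewrite infix11_cons.
  - by [].
have lt' : m - F k < F k.
  by case: k ltm le {IH} => [|k]; [rewrite /=; lia | have := F_leS k; rewrite F_rec; lia].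
case: (IH _ lt') => s v n h; split=> //.
- by rewrite /= s.
- by rewrite val_F_cons v s mul1n; lia.
rewrite infix11_cons negb_or n andbT /=.
case: k ltm {IH lt' s v n} le h => [//|k] ltm le h.
by rewrite h // -ltnNge [k.+1.-1]/=; move: ltm; rewrite F_rec; lia.
Qed.

Lemma del_zeroesP u :
  [/\ head true (del_zeroes u), val_F (del_zeroes u) = val_F u &
      ~~ infix [:: true; true] u -> ~~ infix [:: true; true] (del_zeroes u)].
Proof.
rewrite /del_zeroes; elim: u => //= -[] u [h v n] /=; split=> //.
by rewrite val_F_cons v.
Qed.

Lemma rep_FP m : zeckendorf m (rep_F m).
Proof.
have [_ v n _] := greedyP (F_gt m).
have [h v' n'] := del_zeroesP (greedy m m).
by rewrite /zeckendorf /rep_F h v' v eqxx n'.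
Qed.

Lemma val_F_lt u : ~~ infix [:: true; true] u -> val_F u < F (size u).
Proof.
move: {2}(size u) (leqnn (size u)) => n.
elim: n u => [|n IH] [|b u] //; try by rewrite /val_F big_ord0.
rewrite val_F_cons infix11_cons negb_or [size (b :: u)]/= ltnS => su /andP[hd nu].
case: b hd => hd; last first.
  by rewrite mul0n; apply: leq_trans (IH u su nu) (F_leS _).
case: u su hd nu => [|c u] su hd nu; first by rewrite /val_F big_ord0.
case: c su hd nu => // su _; rewrite infix11_cons => nu.
rewrite val_F_cons mul1n mul0n add0n -[size (_ :: _)]/(size u).+1 F_rec.
by rewrite ltn_add2l; apply: IH (ltnW su) nu.
Qed.

Lemma zeckendorf_uniq m u v : zeckendorf m u -> zeckendorf m v -> u = v.
Proof.
case/and3P=> nu hu /eqP <- /and3P[nv hv /eqP eqv].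
have lo w : head true w -> 0 < size w -> F (size w).-1 <= val_F w.
  by case: w => [|[] w] //= _ _; rewrite val_F_cons mul1n leq_addr.
have sle x y : ~~ infix [:: true; true] x -> head true y ->
    val_F x = val_F y -> size y <= size x.
  move=> nx hy e; case: (posnP (size y)) => [-> //|sy].
  have := lo y hy sy; have := val_F_lt nx; rewrite e => h1 h2.
  rewrite leqNgt; apply/negP => h.
  have : F (size x) <= F (size y).-1 by apply: F_mono; lia.
  lia.
have es : size u = size v.
  by apply/eqP; rewrite eqn_leq (sle u v) // (sle v u).
elim: u v {hu hv sle lo} nu nv eqv es => [|b u IH] [|c v] //.
rewrite !infix11_cons !negb_or => /andP[_ nu] /andP[_ nv] + [es].
rewrite !val_F_cons -es => e.
have := val_F_lt nu; have := val_F_lt nv; rewrite -es => h1 h2.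
have ebc : b = c.
  case: b c e => -[] //; rewrite mul1n mul0n add0n => e.
    by move: h1; rewrite e ltnNge leq_addr.
  by move: h2; rewrite -e ltnNge leq_addr.
by rewrite ebc in e *; move/addnI: e => e; congr (_ :: _); apply: IH.
Qed.

(* Main.v *)
Require Import Defs.
From mathcomp Require Import all_boot.
From mathcomp Require Import zify.

(* Let phi n be the number whose Zeckendorf word is that of n followed by a 0.
   Appending a 0 to ANY binary word acts on values as phi, since the rewriting
   011 -> 100 normalises the word and commutes with appending zeroes. Hence
   phi (phi n) = phi n + n, and phi (n + 1) - phi n is 2 or 1 according to the
   last digit of n. The words w00, w01, w010 have values phi n + n,
   phi n + n + 1 and 2 phi n + n + 2, where n is the value of w. These values
   cover the naturals (look at the last two digits), the last one is never a
   value of phi o phi, and their increments match the recurrence for C; so they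
   are the Raleigh triples, shifted by one. *)

Notation no11 u := (~~ infix [:: true; true] u).

(** * Appending digits to binary words *)

Lemma infix11_rcons (u : seq bool) b c :
  infix [:: true; true] (rcons (rcons u b) c) =
  infix [:: true; true] (rcons u b) || (b && c).
Proof.
elim: u => [|d u IH]; first by case: b; case: c.
rewrite !rcons_cons !infix11_cons IH orbA; congr (_ && _ || _ || _).
by case: u {IH}.
Qed.

Lemma no11_rcons0 (u : seq bool) : no11 u -> no11 (rcons u false).
Proof. by case/lastP: u => // u b nu; rewrite infix11_rcons andbF orbF. Qed.

Lemma no11_rconsW (u : seq bool) b : no11 (rcons u b) -> no11 u.
Proof. by case/lastP: u => // u c; rewrite infix11_rcons negb_or => /andP[]. Qed.

Lemma val_F_nil : val_F [::] = 0.
Proof. by rewrite /val_F big_ord0. Qed.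

Lemma val_F_rcons u b : val_F (rcons u b) = val_F (rcons u false) + b.
Proof.
elim: u => [|c u IH]; first by rewrite !val_F_cons val_F_nil /=; lia.
by rewrite !rcons_cons !val_F_cons IH !size_rcons addnA.
Qed.

Lemma val_F_rcons_rcons0 u b :
  val_F (rcons (rcons u b) false) = val_F (rcons u false) + val_F u + b * 2.
Proof.
elim: u => [|c u IH]; first by rewrite !val_F_cons val_F_nil /=; lia.
rewrite !rcons_cons !val_F_cons IH !size_rcons F_rec; lia.
Qed.

(** One combined rewrite rule: values of extended words reduce to [val_F u] and
    [val_F (rcons u false)], which leaves linear goals. *)
Lemma val_FE :
  (val_F [::] = 0) * (val_F [:: true] = 1) * (val_F [:: false] = 0) *
  (forall u, val_F (rcons u true) = val_F (rcons u false) + 1) *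
  (forall u b,
    val_F (rcons (rcons u b) false) = val_F (rcons u false) + val_F u + b * 2).
Proof.
split; last exact: val_F_rcons_rcons0.
split; last by move=> u; rewrite val_F_rcons.
by rewrite !val_F_cons val_F_nil.
Qed.

(** * Removal of the factor 11 *)

(** By [val_FE] these two numbers determine the same two numbers for any extension of the word, so
    the relation survives appending equal digits on both sides. *)
Definition same_value (u v : seq bool) : Prop :=
  val_F u = val_F v /\ val_F (rcons u false) = val_F (rcons v false).

(* If w ends in 01, rewrite w = x01: x0110 -> x1000, and recurse on x10. *)
Lemma normalize_rcons10 (w : seq bool) : no11 w ->
  exists2 v : seq bool, no11 v & same_value v (rcons (rcons w true) false).
Proof.
move: {2}(size w) (leqnn (size w)) => n.
elim: n w => [|n IH] w; case/lastP: w => [|w b].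
- by exists [:: true; false].
- by rewrite size_rcons.
- by exists [:: true; false].
rewrite size_rcons ltnS => sw nw; case: b nw => nw; last first.
  exists (rcons (rcons (rcons w false) true) false) => //.
  by rewrite !infix11_rcons !andbF !orbF.
case/lastP: w sw nw => [|x c] sw nw.
  exists [:: true; false; false; false] => //.
  by rewrite /same_value /= !val_F_cons val_F_nil.
move: nw sw; rewrite infix11_rcons size_rcons negb_or andbT.
move=> /andP[nx /negbTE->] sx.
have [y ny [v1 v2]] := IH x (ltnW sx) (no11_rconsW _ _ nx).
exists (rcons (rcons y false) false); first by do 2 apply: no11_rcons0.
by move: v1 v2; rewrite /same_value !val_FE; lia.
Qed.

(** Digits are appended one by one. The only carry, x011 to x100, leaves x10 to [normalize_rcons10];
    the word 11 is read as 011. *)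
Lemma normalize u : exists2 v : seq bool, no11 v & same_value v u.
Proof.
elim/last_ind: u => [|u b [v nv [v1 v2]]]; first by exists [::].
case: b; last first.
  by exists (rcons v false); [exact: no11_rcons0|rewrite /same_value !val_FE; lia].
case/lastP: v nv v1 v2 => [|x c] nv v1 v2.
  exists (rcons [::] true) => //.
  by move: v1 v2; rewrite /same_value !val_FE; lia.
case: c nv v1 v2 => nv v1 v2; last first.
  exists (rcons (rcons x false) true); first by rewrite infix11_rcons negb_or nv.
  by move: v1 v2; rewrite /same_value !val_FE; lia.
case/lastP: x nv v1 v2 => [|x c] nv v1 v2.
  exists [:: true; false; false] => //.
  by move: v1 v2; rewrite /same_value !val_FE /= !val_F_cons val_F_nil /=; lia.
move: nv v1 v2; rewrite infix11_rcons negb_or andbT => /andP[nx /negbTE ->] v1 v2.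
have [y ny [w1 w2]] := normalize_rcons10 _ (no11_rconsW _ _ nx).
exists (rcons y false); first exact: no11_rcons0.
by move: v1 v2 w1 w2; rewrite /same_value !val_FE; lia.
Qed.

(** * The shift [phi] of Zeckendorf words *)

Lemma del_zeroes_rcons0 u :
  val_F (rcons (del_zeroes u) false) = val_F (rcons u false).
Proof.
rewrite /del_zeroes; elim: u => //= -[] u IH //=.
by rewrite IH val_F_cons.
Qed.

Lemma rep_F_val_F (u : seq bool) : no11 u -> rep_F (val_F u) = del_zeroes u.
Proof.
move=> nu; apply: zeckendorf_uniq (rep_FP _) _.
by have [h v n] := del_zeroesP u; rewrite /zeckendorf n // h v eqxx.
Qed.

Lemma val_F_rep_F n : val_F (rep_F n) = n.
Proof. by have /and3P[_ _ /eqP] := rep_FP n. Qed.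

Lemma no11_rep_F n : no11 (rep_F n).
Proof. by have /and3P[] := rep_FP n. Qed.

Lemma del_zeroes_rep_F n : del_zeroes (rep_F n) = rep_F n.
Proof.
by have /and3P[_ + _] := rep_FP n; case: (rep_F n) => [|[] u].
Qed.

Definition phi (n : nat) : nat := val_F (rcons (rep_F n) false).

Lemma val_F_rcons0 u : val_F (rcons u false) = phi (val_F u).
Proof.
have [v nv [<- <-]] := normalize u.
by rewrite /phi rep_F_val_F // del_zeroes_rcons0.
Qed.

Lemma phi_phi n : phi (phi n) = phi n + n.
Proof.
have -> : phi (phi n) = val_F (rcons (rcons (rep_F n) false) false).
  by rewrite [RHS]val_F_rcons0.
by rewrite val_FE val_F_rep_F addn0.
Qed.

(** [rep_F n] followed by 1 represents [phi n + 1] even if it contains 11, and [val_F_rcons0]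
    applies to it all the same. *)
Lemma phi_phiS n : phi (phi n).+1 = phi n + n + 2.
Proof.
have -> : (phi n).+1 = val_F (rcons (rep_F n) true) by rewrite val_FE addn1.
by rewrite -val_F_rcons0 val_FE val_F_rep_F.
Qed.

Lemma phi0 : phi 0 = 0. Proof. by rewrite /phi /= val_FE. Qed.

Variant phi_spec (n : nat) : Prop :=
  | PhiEnds0 i of n = phi i
  | PhiEnds01 i of n = phi i + i + 1.

Lemma phiP n : phi_spec n.
Proof.
have := val_F_rep_F n; have := no11_rep_F n.
case/lastP: (rep_F n) => [_ <-|u b].
  by apply: (@PhiEnds0 _ 0); rewrite val_FE phi0.
case: b => [|_ <-]; last first.
  by apply: (@PhiEnds0 _ (val_F u)); rewrite val_F_rcons0.
case/lastP: u => [_ <-|u c].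
  (* The word 1 is read as 01 with an empty prefix. *)
  by apply: (@PhiEnds01 _ 0); rewrite phi0 /= val_FE.
rewrite infix11_rcons negb_or andbT => /andP[_ /negbTE-> <-].
by apply: (@PhiEnds01 _ (val_F u)); rewrite !val_FE val_F_rcons0; lia.
Qed.

Lemma phiS n : phi n.+1 = phi n + 1 \/ phi n.+1 = phi n + 2.
Proof.
case: (phiP n) => i ->.
  by right; rewrite phi_phiS phi_phi.
left; have -> : phi i + i + 1 = (phi (phi i)).+1 by rewrite phi_phi addn1.
(* [rep_F i] followed by 10 has this value, so one more 0 yields its [phi]. *)
have -> : (phi (phi i)).+2 = val_F (rcons (rcons (rep_F i) true) false).
  by rewrite val_FE val_F_rep_F phi_phi -/(phi i); lia.
by rewrite phi_phiS phi_phi -val_F_rcons0 !val_FE val_F_rep_F -/(phi i); lia.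
Qed.

Lemma phi_mono i j : i < j -> phi i < phi j.
Proof.
elim: j => // j IH; have := phiS j.
by rewrite ltnS leq_eqVlt => h /orP[/eqP ->|/IH]; lia.
Qed.

Lemma phi_leq i j : i <= j -> phi i <= phi j.
Proof. by rewrite leq_eqVlt => /orP[/eqP->|/phi_mono/ltnW]. Qed.

Lemma phi_inj : injective phi.
Proof.
by move=> i j e; case: (ltngtP i j) => // /phi_mono; rewrite e ltnn.
Qed.

(** Up to leading zeroes, a Zeckendorf word ends in 00, 01 or 010. *)
Lemma phi_cover n : exists i,
  [\/ n = phi i + i, n = phi i + i + 1 | n = phi i + phi i + i + 2].
Proof.
case: (phiP n) => i ->; last by exists i; constructor 2.
case: (phiP i) => j ->; exists j; first by constructor 1; rewrite phi_phi.
by constructor 3; rewrite -phi_phi addn1 phi_phiS phi_phi; lia.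
Qed.

(* phi (phi i) + 1 lies strictly between phi (phi i) and phi (phi i + 1). *)
Lemma phi_phi_neq i j : phi i + phi i + i + 2 <> phi j + j.
Proof.
have -> : phi i + phi i + i + 2 = phi (phi (phi i)).+1.
  by rewrite phi_phiS phi_phi; lia.
rewrite -phi_phi => /phi_inj e.
case: (leqP j (phi i)) => [|h].
  by rewrite leq_eqVlt => /orP[/eqP ej|/phi_mono]; move: e; rewrite ?ej; lia.
have := phi_leq _ _ h.
by rewrite -e phi_phiS phi_phi; lia.
Qed.

(** * Closed form of the Raleigh triples *)

Lemma raleigh_closed n :
  [/\ raleighA n.+1 = phi n + n + 1, raleighB n.+1 = phi n + n + 2
    & raleighC n.+1 = phi n + phi n + n + 3].
Proof.
elim/ltn_ind: n => -[|n] IH.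
  by have [-> -> ->] := raleigh1; rewrite phi0.
have [hA hB hC] := @raleigh_rec n.+2 isT.
have eA : raleighA n.+2 = phi n.+1 + n.+1 + 1.
  rewrite hA; apply/eqP/mexP; split.
    (* Monotonicity of [phi] puts the earlier A and B below the new value; [phi_phi_neq] excludes
       the earlier C. *)
    apply/negP => /flattenP[s /mapP[i]]; rewrite mem_iota /= add0n => lti ->.
    case: i lti => [|i] lti.
      by have [-> -> ->] := raleigh0; rewrite !inE; lia.
    have [-> -> ->] := IH i lti; rewrite !inE.
    have := @phi_phi_neq i n.+1; have := @phi_mono i n.+1 lti; lia.
  (* Conversely, 0 lies in triple 0, and [phi_cover] puts [k.+1] in a triple [i.+1], where
     monotonicity forces [i < n.+1]. *)
  move=> k; apply: contraR; rewrite -ltnNge; case: k => [_|k ltk].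
    by apply/flattenP; exists [:: 0; 0; 0] => //; apply/mapP; exists 0.
  have [i hi] := phi_cover k.
  have lti : i < n.+1.
    rewrite ltnNge; apply/negP => le_ni; have := phi_leq _ _ le_ni.
    by case: hi; lia.
  apply/flattenP; exists [:: raleighA i.+1; raleighB i.+1; raleighC i.+1].
    by apply/mapP; exists i.+1; rewrite ?mem_iota.
  have [-> -> ->] := IH i lti; rewrite !inE.
  by case: hi; lia.
have [A1 _ C1] := IH n (ltnSn n).
rewrite hB hC eA /= A1 C1; split=> //; first lia.
(* If [phi] grows by d, then A grows by d + 1 and C by 2d + 1, with d = 1 or 2. *)
by case: (phiS n) => ->; case: eqP; lia.
Qed.

(** * Translation between triples and words *)

Lemma eq_upto_zeroes_rep_F (u : seq bool) n :
  no11 u -> val_F u = n -> eq_upto_zeroes (rep_F n) u.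
Proof. by move=> nu <-; rewrite /eq_upto_zeroes del_zeroes_rep_F rep_F_val_F. Qed.

Lemma eq_upto_zeroes_val_F u n : eq_upto_zeroes (rep_F n) u -> n = val_F u.
Proof.
rewrite /eq_upto_zeroes del_zeroes_rep_F => e.
by have [_ <- _] := del_zeroesP u; rewrite -e val_F_rep_F.
Qed.

Lemma val_F_suffixes w (n := val_F w) :
  [/\ val_F (w ++ [:: false; false]) = phi n + n,
      val_F (w ++ [:: false; true]) = phi n + n + 1
    & val_F (w ++ [:: false; true; false]) = phi n + phi n + n + 2].
Proof. by rewrite -!cat_rcons !cats0 !val_FE !val_F_rcons0 /n; split; lia. Qed.

Theorem theorem6p25 (a b c : nat) (ha : 0 < a) (hab : a < b) (hbc : b < c) :
  (exists m : nat,
     1 <= m /\ (a, b, c) = (raleighA m, raleighB m, raleighC m)) <->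
  (exists w : seq bool,
     [/\ eq_upto_zeroes (rep_F (a - 1)) (w ++ [:: false; false]),
         eq_upto_zeroes (rep_F (b - 1)) (w ++ [:: false; true]) &
         eq_upto_zeroes (rep_F (c - 1)) (w ++ [:: false; true; false])]).
Proof.
split=> [[[|n] [// _ []]]|[w [/eq_upto_zeroes_val_F ea /eq_upto_zeroes_val_F eb
                              /eq_upto_zeroes_val_F ec]]].
  have [-> -> ->] := raleigh_closed n; move=> ea eb ec.
  have [va vb vc] := val_F_suffixes (rep_F n).
  (* All three suffixes begin with 0, so no 11 arises at the junction. *)
  have n0 := no11_rcons0 _ (no11_rep_F n).
  rewrite val_F_rep_F in va vb vc.
  exists (rep_F n); split; apply: eq_upto_zeroes_rep_F; rewrite ?va ?vb ?vc; try lia;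
    by rewrite -!cat_rcons !cats0 !infix11_rcons ?andbF ?orbF.
have [va vb vc] := val_F_suffixes w.
exists (val_F w).+1; split=> //; have [-> -> ->] := raleigh_closed (val_F w).
by congr (_, _, _); lia.
Qed.
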